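(* The projective versions of the half-liberations $O_n^*$ and $H_n^*$ are as follows: (1) $PO_n^*=PU_n$; (2) $PH_n^*=PK_n$.
   Context: Compact quantum groups are given by Woronowicz Hopf $C^*$-algebras $C(G)$ generated by the entries of a fundamental matrix $u=(u_{ij})$; quantum groups with the same Hopf $*$-algebra generated by coordinates are identified. $U_n^+$ is the free unitary quantum group: $C(U_n^+)$ is universal with $u$ and $\bar u=(u_{ij}^* )$ unitary. The projective version of a quantum group $G\subset U_n^+$ is the quantum group $PG\subset U_{n^2}^+$ with basic coordinates $v_{ij,kl}=u_{ik}u_{jl}^*$; that is, $C(PG)\subset C(G)$ is the subalgebra generated by these elements. Equality of projective versions means isomorphism mapping standard coordinates $v_{ij,kl}$ to standard coordinates $v_{ij,kl}$. $C(O_n^* )$ is the universal $C^*$-algebra generated by self-adjoint $u_{ij}$ ($1\le i,j\le n$) with $uu^t=u^tu=1$ and half-commutation relations $abc=cba$ for $a,b,c\in\{u_{ij}\}$. $C(H_n^* )$ is its quotient by the cubic relations $u_{ij}u_{ik}=u_{ji}u_{ki}=0$ for all $i$ and all $j\ne k$. $U_n$ is the unitary group. $K_n=\mathbb T\wr S_n$ is the group of $n\times n$ monomial matrices (exactly one nonzero entry on each row and each column) with nonzero entries on the unit circle $\mathbb T$. *)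

(* Defs.v *)
From HB Require Import structures.
From mathcomp Require Import all_boot all_order all_algebra.
From mathcomp Require Import complex.
From mathcomp Require Import all_classical all_reals all_analysis.

Set Implicit Arguments.
Unset Strict Implicit.
Unset Printing Implicit Defensive.

Import Order.TTheory GRing.Theory Num.Theory.
Import numFieldNormedType.Exports.

Local Open Scope classical_set_scope.
Local Open Scope ring_scope.

(* [R[i]] bundled as a numClosedFieldType: the library attaches the topology of
   a numeric field to the projection [Num.ClosedField.sort], so it is found on
   [Cplx R] but not on the bare type [R[i]]. *)
Definition Cplx (R : realType) : numClosedFieldType := R[i].

HB.mixin Record Algebra_hasStar (R : realType) A of GRing.Algebra (Cplx R) A := {
  star : A -> A;
  starK : involutive star;
  starD : {morph star : x y / x + y};
  starM : forall x y : A, star (x * y) = star y * star x;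
  starZ : forall (a : Cplx R) (x : A), star (a *: x) = a^* *: star x
}.

#[short(type="starAlgType")]
HB.structure Definition StarAlgebra (R : realType) :=
  {A of Algebra_hasStar R A & GRing.Algebra (Cplx R) A}.

(* The hierarchy has no join of algebras with normed modules that could be
   extended here, so the norm is a separate operation. As for normed modules
   over [Cplx R], it takes its values in [Cplx R]; its first three laws, which
   make those values nonnegative reals, are those of [Lmodule_isNormed].
   Likewise [0 < e] forces [e : Cplx R] to be real. *)
HB.mixin Record StarAlgebra_isCStar (R : realType) A of StarAlgebra R A := {
  cnorm : A -> Cplx R;
  ler_cnormD : forall x y : A, cnorm (x + y) <= cnorm x + cnorm y;
  cnormZ : forall (a : Cplx R) (x : A), cnorm (a *: x) = `|a| * cnorm x;
  cnorm0_eq0 : forall x : A, cnorm x = 0 -> x = 0;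
  ler_cnormM : forall x y : A, cnorm (x * y) <= cnorm x * cnorm y;
  cnorm_star : forall x : A, cnorm (star x * x) = cnorm x ^+ 2;
  cnorm_complete : forall s : nat -> A,
    (forall e : Cplx R, 0 < e -> exists N, forall p q : nat,
       (N <= p)%N -> (N <= q)%N -> cnorm (s p - s q) < e) ->
    exists l : A, forall e : Cplx R, 0 < e -> exists N, forall p : nat,
       (N <= p)%N -> cnorm (s p - l) < e
}.

#[short(type="cstarAlgType")]
HB.structure Definition CStarAlgebra (R : realType) :=
  {A of StarAlgebra_isCStar R A & StarAlgebra R A}.

Definition star_hom (R : realType) (A B : starAlgType R)
    (f : {lrmorphism A -> B}) : Prop :=
  forall x, f (star x) = star (f x).

(* (A, u) is the universal C*-algebra generated by the entries of a matrix
   subject to the relations [rel]. *)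
Definition universal_cstar (R : realType) (n : nat)
    (rel : forall B : cstarAlgType R, 'M[B]_n -> Prop)
    (A : cstarAlgType R) (u : 'M[A]_n) : Prop :=
  rel A u /\
  forall (B : cstarAlgType R) (w : 'M[B]_n), rel B w ->
    exists f : {lrmorphism A -> B},
      [/\ star_hom f, (forall i j, f (u i j) = w i j) &
          forall g : {lrmorphism A -> B},
            star_hom g -> (forall i j, g (u i j) = w i j) -> g =1 f].

Definition Ostar_rel (R : realType) (n : nat) (B : cstarAlgType R)
    (w : 'M[B]_n) : Prop :=
  [/\ forall i j, star (w i j) = w i j,
      w *m w^T = 1%:M,
      w^T *m w = 1%:M &
      forall i1 j1 i2 j2 i3 j3,
        w i1 j1 * w i2 j2 * w i3 j3 = w i3 j3 * w i2 j2 * w i1 j1].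

Definition Hstar_rel (R : realType) (n : nat) (B : cstarAlgType R)
    (w : 'M[B]_n) : Prop :=
  Ostar_rel w /\
  forall i j k, j != k -> w i j * w i k = 0 /\ w j i * w k i = 0.

Definition is_C_Ostar (R : realType) (n : nat) (A : cstarAlgType R)
    (u : 'M[A]_n) : Prop := universal_cstar (@Ostar_rel R n) u.

Definition is_C_Hstar (R : realType) (n : nat) (A : cstarAlgType R)
    (u : 'M[A]_n) : Prop := universal_cstar (@Hstar_rel R n) u.

Section continuous_functions.
Variables (R : realType) (X : ptopologicalType).
Local Notation C := (Cplx R).
Local Notation CX := (continuousType X C).
Implicit Types (f g h : CX) (a : C).

Lemma cfun_cst_subproof a : continuous (fun _ : X => a).
Proof. exact: cst_continuous. Qed.
Lemma cfun_add_subproof f g : continuous (fun x => f x + g x).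
Proof. by move=> x; apply: cvgD; exact: cts_fun. Qed.
Lemma cfun_opp_subproof f : continuous (fun x => - f x).
Proof. by move=> x; apply: cvgN; exact: cts_fun. Qed.
Lemma cfun_mul_subproof f g : continuous (fun x => f x * g x).
Proof. by move=> x; apply: cvgM; exact: cts_fun. Qed.
Lemma cfun_conj_subproof f : continuous (fun x => (f x)^*).
Proof.
move=> x; apply/cvgrPdist_lt => e e0.
have /cvgrPdist_lt/(_ _ e0) := @cts_fun _ _ f x.
by apply: filterS => y; rewrite -rmorphB norm_conjC.
Qed.

Definition cfun_cst a : CX := mkcts (@cfun_cst_subproof a).
Definition cfun_add f g : CX := mkcts (@cfun_add_subproof f g).
Definition cfun_opp f : CX := mkcts (@cfun_opp_subproof f).
Definition cfun_mul f g : CX := mkcts (@cfun_mul_subproof f g).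
Definition cfun_scale a f : CX := cfun_mul (cfun_cst a) f.
Definition cfun_star f : CX := mkcts (@cfun_conj_subproof f).

Fact cfun_addA : associative cfun_add.
Proof. by move=> f g h; apply/continuousEP => x; exact: addrA. Qed.
Fact cfun_addC : commutative cfun_add.
Proof. by move=> f g; apply/continuousEP => x; exact: addrC. Qed.
Fact cfun_add0 : left_id (cfun_cst 0) cfun_add.
Proof. by move=> f; apply/continuousEP => x; exact: add0r. Qed.
Fact cfun_addN : left_inverse (cfun_cst 0) cfun_opp cfun_add.
Proof. by move=> f; apply/continuousEP => x; exact: addNr. Qed.

HB.instance Definition _ :=
  GRing.isZmodule.Build CX cfun_addA cfun_addC cfun_add0 cfun_addN.

Fact cfun_mulA : associative cfun_mul.
Proof. by move=> f g h; apply/continuousEP => x; exact: mulrA. Qed.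
Fact cfun_mulC : commutative cfun_mul.
Proof. by move=> f g; apply/continuousEP => x; exact: mulrC. Qed.
Fact cfun_mul1 : left_id (cfun_cst 1) cfun_mul.
Proof. by move=> f; apply/continuousEP => x; exact: mul1r. Qed.
Fact cfun_mulDl : left_distributive cfun_mul cfun_add.
Proof. by move=> f g h; apply/continuousEP => x; exact: mulrDl. Qed.
Fact cfun_1neq0 : cfun_cst 1 != 0.
Proof.
by apply/eqP => /continuousEP/(_ point) /eqP; apply/negP; exact: oner_neq0.
Qed.

HB.instance Definition _ := GRing.Zmodule_isComNzRing.Build CX
  cfun_mulA cfun_mulC cfun_mul1 cfun_mulDl cfun_1neq0.

Fact cfun_scaleA a b f : cfun_scale a (cfun_scale b f) = cfun_scale (a * b) f.
Proof. by apply/continuousEP => x; exact: mulrA. Qed.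
Fact cfun_scale1 : left_id 1 cfun_scale.
Proof. by move=> f; apply/continuousEP => x; exact: mul1r. Qed.
Fact cfun_scaleDr : right_distributive cfun_scale +%R.
Proof. by move=> a f g; apply/continuousEP => x; exact: mulrDr. Qed.
Fact cfun_scaleDl f : {morph cfun_scale^~ f : a b / a + b}.
Proof. by move=> a b; apply/continuousEP => x; exact: mulrDl. Qed.

HB.instance Definition _ := GRing.Zmodule_isLmodule.Build C CX
  cfun_scaleA cfun_scale1 cfun_scaleDr cfun_scaleDl.

Fact cfun_scaleAl a f g : a *: (f * g) = (a *: f) * g.
Proof. by apply/continuousEP => x; exact: mulrA. Qed.

HB.instance Definition _ :=
  GRing.LSemiModule_isLSemiAlgebra.Build C CX cfun_scaleAl.

Fact cfun_scaleAr a f g : a *: (f * g) = f * (a *: g).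
Proof. by apply/continuousEP => x; exact: mulrCA. Qed.

HB.instance Definition _ :=
  GRing.LSemiAlgebra_isSemiAlgebra.Build C CX cfun_scaleAr.

Fact cfun_starK : involutive cfun_star.
Proof. by move=> f; apply/continuousEP => x; exact: conjCK. Qed.
Fact cfun_starD : {morph cfun_star : f g / f + g}.
Proof. by move=> f g; apply/continuousEP => x; exact: rmorphD. Qed.
Fact cfun_starM f g : cfun_star (f * g) = cfun_star g * cfun_star f.
Proof. by rewrite mulrC; apply/continuousEP => x; exact: rmorphM. Qed.
Fact cfun_starZ a f : cfun_star (a *: f) = a^* *: cfun_star f.
Proof. by apply/continuousEP => x; exact: rmorphM. Qed.

HB.instance Definition _ := Algebra_hasStar.Build R CX
  cfun_starK cfun_starD cfun_starM cfun_starZ.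

End continuous_functions.

Definition unitary_group (R : realType) (n : nat) : set 'M[Cplx R]_n :=
  [set M | M \is unitarymx].

Definition monomial_group (R : realType) (n : nat) : set 'M[Cplx R]_n :=
  [set M | [/\ forall i, exists! j, M i j != 0,
               forall j, exists! i, M i j != 0 &
               forall i j, M i j != 0 -> `|M i j| = 1]].

Definition Ugrp (R : realType) (n : nat) := set_type (@unitary_group R n).
Definition Kgrp (R : realType) (n : nat) := set_type (@monomial_group R n).

Lemma unitary_group1 (R : realType) (n : nat) :
  (1%:M : 'M[Cplx R]_n) \in @unitary_group R n.
Proof.
by rewrite inE; apply/unitarymxP; rewrite trmx1 map_mx1 mulmx1.
Qed.

Lemma monomial_group1 (R : realType) (n : nat) :
  (1%:M : 'M[Cplx R]_n) \in @monomial_group R n.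
Proof.
have E (i j : 'I_n) : ((1%:M : 'M[Cplx R]_n) i j != 0) = (i == j).
  by rewrite mxE; case: (i == j); rewrite ?oner_neq0 ?eqxx.
rewrite inE; split.
- by move=> i; exists i; split=> [|j]; rewrite E // => /eqP.
- by move=> j; exists j; split=> [|i]; rewrite E // => /eqP.
- by move=> i j; rewrite E => /eqP ->; rewrite mxE eqxx normr1.
Qed.

HB.instance Definition _ (R : realType) (n : nat) :=
  Topological.copy (Ugrp R n) (set_type (@unitary_group R n)).
HB.instance Definition _ (R : realType) (n : nat) :=
  isPointed.Build (Ugrp R n) (exist (fun M => M \in @unitary_group R n) 1%:M (unitary_group1 R n)).
HB.instance Definition _ (R : realType) (n : nat) :=
  Topological.copy (Kgrp R n) (set_type (@monomial_group R n)).
HB.instance Definition _ (R : realType) (n : nat) :=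
  isPointed.Build (Kgrp R n) (exist (fun M => M \in @monomial_group R n) 1%:M (monomial_group1 R n)).

Lemma coord_cts (R : realType) (n : nat) (G : set 'M[Cplx R]_n) (i j : 'I_n) :
  continuous (fun x : set_type G => set_val x i j : Cplx R).
Proof.
move=> x; apply: (@continuous_comp _ _ _ set_val (fun M : 'M[Cplx R]_n => M i j)).
  exact: initial_continuous.
exact: coord_continuous.
Qed.

Definition CU (R : realType) (n : nat) : starAlgType R :=
  continuousType (Ugrp R n) (Cplx R).
Definition CK (R : realType) (n : nat) : starAlgType R :=
  continuousType (Kgrp R n) (Cplx R).

Definition Ucoord (R : realType) (n : nat) : 'M[CU R n]_n :=
  \matrix_(i, j)
    (mkcts (@coord_cts R n (@unitary_group R n) i j) :
      continuousType (Ugrp R n) (Cplx R)).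
Definition Kcoord (R : realType) (n : nat) : 'M[CK R n]_n :=
  \matrix_(i, j)
    (mkcts (@coord_cts R n (@monomial_group R n) i j) :
      continuousType (Kgrp R n) (Cplx R)).

Definition star_subalgebra (R : realType) (A : starAlgType R) (P : set A) : Prop :=
  [/\ P 1,
      forall x y, P x -> P y -> P (x + y),
      forall x y, P x -> P y -> P (x * y),
      forall (a : Cplx R) x, P x -> P (a *: x) &
      forall x, P x -> P (star x)].

Definition generated (R : realType) (A : starAlgType R) (I : Type)
    (v : I -> I -> A) : set A :=
  smallest (@star_subalgebra R A) [set v a b | a in setT & b in setT].

(* Matrices of coordinates in *-algebras define the same quantum group when
   the *-algebras generated by these coordinates are isomorphic by an
   isomorphism mapping coordinates to coordinates. The values of [f] outside
   the generated *-algebra are irrelevant. *)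
Definition same_qgroup (R : realType) (A B : starAlgType R) (I : Type)
    (v : I -> I -> A) (w : I -> I -> B) : Prop :=
  let P := generated v in
  exists f : A -> B,
    set_bij P (generated w) f /\
    [/\ f 1 = 1,
        forall x y, P x -> P y -> f (x + y) = f x + f y,
        forall x y, P x -> P y -> f (x * y) = f x * f y,
        forall (a : Cplx R) x, P x -> f (a *: x) = a *: f x &
        forall x, P x -> f (star x) = star (f x)] /\
    forall a b, f (v a b) = w a b.

Definition projective (R : realType) (n : nat) (A : starAlgType R)
    (u : 'M[A]_n) (ij kl : 'I_n * 'I_n) : A :=
  u ij.1 kl.1 * star (u ij.2 kl.2).

(* Main.v *)
(** Sending u_ij to the antidiagonal 2x2 matrix with entries g_ij and its
    conjugate, for g in U_n (resp. K_n), gives representations of C(O_n^* )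
    (resp. C(H_n^* )) under which every relation between the coordinates
    u_ik u_jl becomes a relation between the functions g_ik conj(g_jl).

    Conversely, the elements u_ik u_jl commute and behave like the entries of
    a rank one tensor. Fix a, b and put x_ij = u_ij u_ab, y_ij = u_ab u_ij and
    c = u_ab^2: these commute, x_ij y_kl = c u_ij u_kl and x y^T = c, so that y
    is, up to det x and c, the cofactor matrix of x. A relation p between the
    functions g_ik conj(g_jl) thus becomes a polynomial q(x, cofactor x) = 0
    on the group. For U_n, q vanishes at all matrices over all commutative
    algebras: diagonalisation passes from the torus to Hermitian matrices,
    which are a real form of M_n(C). For K_n, the partition of unity
    e_f = prod_i u_{i f(i)}^2 reduces to x supported on the graph of f, where
    density of the torus suffices. As det x is a divisor of a power of c, some
    power of c annihilates p(u, u); since sum_b u_ab^2 = 1, p(u, u) = 0. *)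

From HB Require Import structures.
Require Import Defs.
From mathcomp Require Import all_boot all_order all_algebra.
From mathcomp Require Import complex.
From mathcomp Require Import ring zify.
From mathcomp Require Import all_classical all_reals all_analysis.

Set Implicit Arguments.
Unset Strict Implicit.
Unset Printing Implicit Defensive.

Import Order.TTheory GRing.Theory Num.Theory.
Import numFieldNormedType.Exports.

Local Open Scope classical_set_scope.
Local Open Scope ring_scope.
Local Open Scope sesquilinear_scope.

(** * Polynomial laws *)

Section polynomial_laws.
Variable C : fieldType.

(** Differences of distinct scalars are units in [B], so linear factors split off one at a time even
    when [B] has zero divisors. *)
Lemma poly_eq0_scalar_roots (B : comNzRingType) (h : {rmorphism C -> B})
    (p : {poly B}) (s : seq C) :
  uniq s -> (size p <= size s)%N -> (forall c, c \in s -> p.[h c] = 0) -> p = 0.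
Proof.
elim: s p => [p _ /size_poly_leq0P //|c s IHs p /= /andP[cs us] sp p0].
have /factor_theorem[q pE] : root p (h c) by apply/rootP/p0/mem_head.
have qE : q = 0.
  apply: IHs => //.
    have [->|q0] := eqVneq q 0; first by rewrite size_poly0.
    by move: sp; rewrite pE size_Mmonic ?monicXsubC// size_XsubC addn2.
  move=> d ds; have := p0 d; rewrite inE ds orbT => /(_ isT).
  rewrite pE hornerM hornerXsubC -rmorphB => /(congr1 (fun x => x * h (d - c)^-1)).
  rewrite -mulrA -rmorphM mulfV ?rmorph1 ?mulr1 ?mul0r//.
  by rewrite subr_eq0; apply: contraNneq cs => <-.
by rewrite pE qE mul0r.
Qed.

(* A polynomial law in the sense of Roby: its two arguments are the image of
   the scalars in the ring B and the coordinates of a B-point. *)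
Definition poly_law (I : Type) :=
  forall B : comNzRingType, (C -> B) -> (I -> B) -> B.

Definition natural_law (I : Type) (q : poly_law I) : Prop :=
  forall (B B' : comNzRingType) (f : {rmorphism B -> B'}) (h : C -> B) (x : I -> B),
    f (q B h x) = q B' (f \o h) (f \o x).

(** Coordinates are freed from [S] one at a time: an indeterminate in place of one coordinate gives
    a polynomial over [B], which by induction vanishes at as many scalars of [S] as its size. *)
Lemma natural_law_eq0 (I : finType) (q : poly_law I) (S : C -> Prop) :
  natural_law q -> (forall m, exists s : seq C,
    [/\ uniq s, size s = m & forall c, c \in s -> S c]) ->
  (forall x : I -> C, (forall i, S (x i)) -> q C id x = 0) ->
  forall (B : comNzRingType) (h : {rmorphism C -> B}) (x : I -> B), q B h x = 0.
Proof.
move=> qN Sinf q0 B h x.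
suff H (s : seq I) (y : I -> B) :
    (forall i, i \notin s -> exists2 c, S c & y i = h c) -> q B h y = 0.
  by apply: (H (enum I)) => i; rewrite mem_enum.
elim: s y => [|i s IHs] y yS.
  (* No coordinate is free: the point is the image under [h] of a point over [C], and naturality
     along [h] applies. *)
  have /choice[z zP] : forall i, exists c, S c /\ y i = h c.
    by move=> i; have [//|c] := yS i; exists c.
  have -> : y = h \o z by apply/funext => i; rewrite (zP i).2.
  have -> : (h : C -> B) = h \o id by [].
  by rewrite -qN q0 ?rmorph0 // => i; have [] := zP i.
pose Y j : {poly B} := if j == i then 'X else (y j)%:P.
pose p := q {poly B} (polyC \o h) Y.
have pE b : p.[b] = q B h (fun j => if j == i then b else y j).
  rewrite -/(horner_eval b p) [LHS]qN; congr (q B _ _); apply/funext => j /=.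
    by rewrite /horner_eval hornerC.
  by rewrite /horner_eval /Y; case: eqP; rewrite ?hornerX ?hornerC.
suff p0 : p = 0.
  have := pE (y i); rewrite p0 horner0 => ->; congr (q B _ _).
  by apply/funext => j; case: eqP => [->|].
have [t [ut st tS]] := Sinf (size p).
apply: (poly_eq0_scalar_roots ut); first by rewrite st.
move=> c ct; rewrite pE; apply: IHs => j js; case: eqP => ji.
  by exists c => //; apply: tS.
by apply: yS; rewrite inE negb_or js andbT; apply/eqP.
Qed.

End polynomial_laws.

(** * Laws on matrices: from unitary matrices to all matrices *)

Section matrix_laws.
Variables (C : numClosedFieldType) (n : nat).

Definition mx_law := forall B : comNzRingType, (C -> B) -> 'M[B]_n -> B.

Definition natural_mx_law (q : mx_law) : Prop :=
  forall (B B' : comNzRingType) (f : {rmorphism B -> B'}) (h : C -> B) (X : 'M[B]_n),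
    f (q B h X) = q B' (f \o h) (map_mx f X).

Lemma infinite_real (m : nat) :
  exists s : seq C, [/\ uniq s, size s = m & forall c, c \in s -> c \is Num.real].
Proof.
exists [seq i%:R | i <- iota 0 m]; split=> [||c /mapP[i _ ->]].
- rewrite map_inj_uniq ?iota_uniq// => i j /eqP.
  by rewrite eqr_nat => /eqP.
- by rewrite size_map size_iota.
- exact: realn.
Qed.

(** The Cayley transform $t \mapsto (1 + it)/(1 - it)$ maps the reals injectively into the
    circle. *)
Lemma infinite_circle (m : nat) :
  exists s : seq C, [/\ uniq s, size s = m & forall c, c \in s -> `|c| = 1].
Proof.
have [s [us sm sR]] := infinite_real m.
pose z (t : C) : C := 1 + 'i * t.
have zN (t : C) : t \is Num.real -> `|1 - 'i * t| = `|z t|.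
  move=> tR; rewrite -[RHS]norm_conjC /z rmorphD rmorphM rmorph1 /= conjCi.
  by rewrite (CrealP tR) mulNr.
have z0 (t : C) : t \is Num.real -> 1 - 'i * t != 0.
  move=> tR; apply/eqP => /(congr1 (fun x => x * z t)).
  rewrite mul0r /z -subr_sqr expr1n exprMn sqrCi mulN1r opprK => /eqP.
  by apply/negP; rewrite gt_eqF// ltr_pwDl// real_exprn_even_ge0.
exists [seq z t / (1 - 'i * t) | t <- s]; split.
- rewrite map_inj_in_uniq// => t t' ts t's /eqP.
  rewrite eqr_div ?z0 ?sR// /z => /eqP H.
  have : 2 * 'i * (t - t') = 0.
    transitivity ((1 + 'i * t) * (1 - 'i * t') - (1 + 'i * t') * (1 - 'i * t)).
      ring.
    by rewrite H subrr.
  move/eqP; rewrite !mulf_eq0 pnatr_eq0/= (negPf (neq0Ci _))/= subr_eq0.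
  by move/eqP.
- by rewrite size_map.
- move=> _ /mapP[t ts ->]; rewrite normf_div zN ?sR// divff//.
  by rewrite normr_eq0 -normr_eq0 -zN ?sR// normr_eq0 z0 ?sR.
Qed.

Variables (q : mx_law) (qN : natural_mx_law q).

(** In a fixed unitary eigenbasis of [H], the law on diagonal matrices vanishes on the torus, hence
    also at the eigenvalues of [H]. *)
Lemma hermitian_law_eq0 : (forall g : 'M[C]_n, g \is unitarymx -> q id g = 0) ->
  forall H : 'M[C]_n, H \is hermsymmx -> q id H = 0.
Proof.
move=> q0 H /hermitian_normalmx/orthomx_spectralP ->.
set V := spectralmx H; set d := spectral_diag H.
have Vu : V \is unitarymx by apply: spectral_unitarymx.
pose Q : poly_law C 'I_n := fun B h x =>
  q h (map_mx h (invmx V) *m diag_mx (\row_i x i) *m map_mx h V).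
have QN : natural_law Q.
  move=> B B' f h x; rewrite /Q qN !map_mxM map_diag_mx -!map_mx_comp.
  by congr (q _ (_ *m diag_mx _ *m _)); apply/matrixP => i j; rewrite !mxE.
have QE (x : 'I_n -> C) : Q C id x = q id (invmx V *m diag_mx (\row_i x i) *m V).
  by rewrite /Q !map_mx_id.
have -> : d = \row_i d 0 i by apply/rowP => i; rewrite mxE.
rewrite -QE; apply: (natural_law_eq0 QN infinite_circle _ idfun) => x x1.
rewrite QE; apply: q0.
rewrite !mul_unitarymx//; first by rewrite invmx_unitary// trmxC_unitary.
apply/unitarymxP/matrixP => i j.
have -> : (diag_mx (\row_i x i))^t* = diag_mx (\row_i (x i)^*).
  rewrite tr_diag_mx map_diag_mx; congr diag_mx.
  by apply/rowP => k; rewrite !mxE.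
by rewrite mul_diag_mx !mxE mulrnAr -normCK x1 expr1n.
Qed.

Lemma unitary_law_eq0 : (forall g : 'M[C]_n, g \is unitarymx -> q id g = 0) ->
  forall (B : comNzRingType) (h : {rmorphism C -> B}) (X : 'M[B]_n), q h X = 0.
Proof.
move=> q0 B h X.
(* [aM + bM^T] is Hermitian for [M] real, and any matrix has this form for
   some complex [M]. *)
pose a : C := (1 + 'i) / 2; pose b : C := (1 - 'i) / 2.
pose M (B : comNzRingType) (h : C -> B) (x : 'I_n * 'I_n -> B) : 'M[B]_n :=
  let Y := \matrix_(i, j) x (i, j) in h a *: Y + h b *: Y^T.
pose Q : poly_law C ('I_n * 'I_n)%type := fun B h x => q h (M B h x).
have QN : natural_law Q.
  move=> D D' f k x; rewrite /Q qN; congr (q _ _).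
  by apply/matrixP => i j; rewrite !mxE rmorphD !rmorphM.
(* As $a^2 - b^2 = i$, this [Y] solves $X = aY + bY^T$. *)
pose Y := h (- 'i) *: (h a *: X - h b *: X^T).
have -> : X = M B h (fun e => Y e.1 e.2).
  apply/matrixP => i j; rewrite !mxE.
  transitivity (h (- 'i * (a * a - b * b)) * X i j).
    have -> : - 'i * (a * a - b * b) = 1.
      by rewrite /a /b -[RHS]opprK -(sqrCi C); field.
    by rewrite rmorph1 mul1r.
  rewrite rmorphM rmorphB !rmorphM; ring.
apply: (@natural_law_eq0 C _ Q (fun c => c \is Num.real) QN infinite_real).
move=> x xR; apply: hermitian_law_eq0 => //.
apply/is_hermitianmxP; rewrite expr0 scale1r; apply/matrixP => i j; rewrite !mxE.
have xC k : (x k)^* = x k by apply: CrealP (xR k).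
have Ca : a^* = b by rewrite rmorphM fmorphV rmorphD rmorph1 /= conjCi rmorph_nat.
have Cb : b^* = a by rewrite -Ca conjCK.
move: Ca Cb; rewrite -/a -/b; move: a b {M Q QN Y} => a b Ca Cb.
by rewrite rmorphD !rmorphM /= !xC Ca Cb addrC.
Qed.

End matrix_laws.

Lemma prodrMl_seq (B : comNzRingType) (T : Type) (s : seq T) (x : B) (F : T -> B) :
  \prod_(e <- s) (x * F e) = x ^+ size s * \prod_(e <- s) F e.
Proof.
elim: s => [|e s IHs]; first by rewrite !big_nil mulr1.
by rewrite !big_cons IHs exprS /=; ring.
Qed.

(** * Relations as lists of monomials *)

Section noncommutative_polynomials.
Variable K : Type.

(* A list of monomials: a coefficient and the pairs (a, b) of indices of its
   factors [v a b]. *)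
Definition ncpoly (J : Type) := seq (K * seq (J * J)).

Definition com_eval (J : Type) (B : comNzRingType) (h : K -> B) (v : J -> J -> B)
    (L : ncpoly J) : B :=
  \sum_(m <- L) h m.1 * \prod_(e <- m.2) v e.1 e.2.

Lemma com_eval_natural (J : Type) (B B' : comNzRingType) (f : {rmorphism B -> B'})
    (h : K -> B) (v : J -> J -> B) (L : ncpoly J) :
  f (com_eval h v L) = com_eval (f \o h) (fun a b => f (v a b)) L.
Proof.
by rewrite rmorph_sum; apply: eq_bigr => m _; rewrite rmorphM rmorph_prod.
Qed.

End noncommutative_polynomials.

(** * Elimination of conjugates by the adjugate *)

Section adjugate_law.
Variables (C : numClosedFieldType) (n : nat).
Local Notation I := ('I_n * 'I_n)%type.
Implicit Types (L : ncpoly C I) (B : comNzRingType).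

(* The relation [L] with [conj g] replaced by the cofactor matrix of [X], made
   homogeneous by powers of the determinant; [N] bounds the lengths of the
   monomials of [L]. *)
Definition adj_law L (N : nat) : mx_law C n := fun B h X =>
  \sum_(m <- L) h m.1 * (\det X ^+ (N - size m.2) *
    \prod_(e <- m.2) (X e.1.1 e.2.1 * (\adj X) e.2.2 e.1.2)).

Lemma adj_law_natural L N : natural_mx_law (adj_law L N).
Proof.
move=> B B' f h X; rewrite rmorph_sum; apply: eq_bigr => m _.
rewrite !rmorphM rmorphXn rmorph_prod det_map_mx; congr (_ * (_ * _)).
by apply: eq_bigr => e _; rewrite rmorphM -map_mx_adj !mxE.
Qed.

(** Since $\mathrm{adj}\, g = \det g \cdot g^*$, each factor of a monomial contributes one $\det g$,
    and the padding brings the exponent to [N] in every monomial. *)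
Lemma adj_law_unitary L N (g : 'M[C]_n) :
  g \is unitarymx -> (forall m, m \in L -> (size m.2 <= N)%N) ->
  adj_law L N id g =
    \det g ^+ N * com_eval id (fun ij kl => g ij.1 kl.1 * (g ij.2 kl.2)^*) L.
Proof.
move=> /unitarymxP gu LN; rewrite /com_eval big_distrr/= /adj_law big_seq.
rewrite [RHS]big_seq; apply: eq_bigr => m mL.
rewrite mulrCA -{2}(subnK (LN m mL)) exprD -!mulrA [in RHS](mulrCA (\det g ^+ size _)).
congr (_ * (_ * _)).
have adjE : \adj g = \det g *: g^t*.
  by rewrite -[LHS]mulmx1 -gu mulmxA mul_adj_mx mul_scalar_mx.
rewrite -prodrMl_seq; apply: eq_bigr => e _.
by rewrite adjE !mxE; ring.
Qed.

(** The adjugate is homogeneous of degree $n - 1$, so each factor $X_{ik}\,\mathrm{adj}(X)_{lj}$ has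
    degree $n$, as does the determinant that pads for a missing factor. *)
Lemma adj_law_scale L N B (h : C -> B) (X : 'M[B]_n) (e : B) : (0 < n)%N ->
  (forall m, m \in L -> (size m.2 <= N)%N) ->
  adj_law L N h (e *: X) = e ^+ (n * N) * adj_law L N h X.
Proof.
move=> n0 LN; rewrite /adj_law big_distrr/= big_seq.
rewrite [RHS]big_seq; apply: eq_bigr => m mL.
rewrite [RHS]mulrCA; congr (_ * _); rewrite detZ exprMn -exprM.
have -> : (n * N = n * (N - size m.2) + n * size m.2)%N.
  by rewrite -mulnDr subnK ?LN.
rewrite exprD -!mulrA; congr (_ * _).
rewrite mulrCA; congr (_ * _); rewrite [e ^+ (_ * size _)]exprM -prodrMl_seq.
apply: eq_bigr => d _; rewrite adjZ !mxE.
have -> : e ^+ n = e * e ^+ n.-1 by rewrite -exprS prednK.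
by ring.
Qed.

(** From $XY^T = c$ follows $c\,\mathrm{adj}\,X = \det X \cdot Y^T$; one factor $c$ per adjugate
    entry then trades the adjugate for [Y]. *)
Lemma adj_law_rank1 L N B (h : C -> B) (X Y : 'M[B]_n) (c : B) (v : I -> I -> B) :
  (forall m, m \in L -> (size m.2 <= N)%N) ->
  X *m Y^T = c%:M ->
  (forall i j k l, X i k * Y j l = c * v (i, j) (k, l)) ->
  c ^+ N * adj_law L N h X = (\det X * c) ^+ N * com_eval h v L.
Proof.
move=> LN XY Xv; rewrite /com_eval /adj_law !big_distrr/= big_seq.
rewrite [RHS]big_seq; apply: eq_bigr => m mL.
have adjE : c *: \adj X = \det X *: Y^T.
  by rewrite -mul_mx_scalar -XY mulmxA mul_adj_mx mul_scalar_mx.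
rewrite mulrCA [RHS]mulrCA; congr (_ * _).
have [r NE] : exists r, N = (r + size m.2)%N.
  by exists (N - size m.2)%N; rewrite subnK ?LN.
rewrite NE addnK exprMn !exprD.
transitivity (c ^+ r * \det X ^+ r *
    (c ^+ size m.2 * \prod_(e <- m.2) (X e.1.1 e.2.1 * (\adj X) e.2.2 e.1.2))).
  by ring.
rewrite -prodrMl_seq.
transitivity (c ^+ r * \det X ^+ r *
    ((\det X * c) ^+ size m.2 * \prod_(e <- m.2) v e.1 e.2)); last first.
  by rewrite exprMn; ring.
rewrite -prodrMl_seq; congr (_ * _); apply: eq_bigr => -[[i j] [k l]] _ /=.
rewrite -mulrA -Xv mulrCA [RHS]mulrCA; congr (_ * _).
by have /matrixP/(_ l j) := adjE; rewrite !mxE.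
Qed.

End adjugate_law.

(** The elements having a power that kills [a] are closed under addition, and so include $1$. *)
Lemma sum1_annihilator (B : comNzRingType) (T : finType) (c : T -> B) (a : B) :
  \sum_t c t = 1 -> (forall t, exists N, c t ^+ N * a = 0) -> a = 0.
Proof.
move=> c1 ca; rewrite -[a]mul1r -(expr1n _ 0).
suff [N] : exists N, (\sum_t c t) ^+ N * a = 0 by rewrite c1 !expr1n.
elim/big_ind: _ => [|x y [M xM] [N yN]|t _]; [by exists 1; rewrite expr1 mul0r| |exact: ca].
exists (M + N); rewrite exprDn big_distrl/= big1// => i _.
(* In each binomial term, either [x] has exponent at least [M] or [y] has exponent above [N]. *)
rewrite mulrnAl; have [iN|Ni] := leqP i N.
  have -> : (M + N - i = (N - i) + M)%N by lia.
  by rewrite exprD -!mulrA [_ ^+ M * _]mulrCA xM !mulr0 mul0rn.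
by rewrite -(subnK (ltnW Ni)) exprD -!mulrA yN !mulr0 mul0rn.
Qed.

(** * Projective relations in a commutative ring *)

Lemma monomial_unitarymx (C : numClosedFieldType) (n : nat)
    (f : {ffun 'I_n -> 'I_n}) (t : 'I_n -> C) :
  injective f -> (forall i, `|t i| = 1) ->
  (\matrix_(i, j) (t i *+ (f i == j)) : 'M[C]_n) \is unitarymx.
Proof.
move=> finj t1; apply/unitarymxP/matrixP => i j; rewrite !mxE.
rewrite (bigD1 (f i))//= big1 ?addr0 => [|k /negPf fk]; last first.
  by rewrite !mxE eq_sym fk mul0r.
rewrite !mxE eqxx (inj_eq finj) eq_sym; case: eqP => [->|_].
  by rewrite -normCK t1 expr1n.
by rewrite rmorph0 mulr0.
Qed.

(* [v (i, j) (k, l)] stands for [u i k * u j l]. *)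
Section projective_relations.
Variables (C : numClosedFieldType) (n : nat) (B : comNzRingType).
Variables (h : {rmorphism C -> B}).
Local Notation I := ('I_n * 'I_n)%type.
Variables (v : I -> I -> B).
Hypothesis v_swap : forall i j k l a b c d,
  v (i, j) (k, l) * v (a, b) (c, d) = v (i, b) (k, d) * v (a, j) (c, l).
Hypothesis v_row : forall i j, \sum_k v (i, j) (k, k) = (i == j)%:R.
Variables (L : ncpoly C I) (N : nat).
Hypothesis LN : forall m, m \in L -> (size m.2 <= N)%N.

(** Stands for the matrix of the $u_{ik} u_{ab}$: the coordinates, made even by one fixed
    coordinate. *)
Definition shift_mx (a b : 'I_n) : 'M[B]_n := \matrix_(i, k) v (i, a) (k, b).

(** The weight [e] localizes the argument: it is $1$ for the unitary group and a member of a
    partition of unity for the monomial group. *)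
Lemma shift_law_eq0 (e : B) : (0 < n)%N ->
  (forall a b, adj_law L N h (e *: shift_mx a b) = 0) ->
  e ^+ (n * N) * com_eval h v L = 0.
Proof.
move=> n0 q0; pose a := Ordinal n0.
(* The squares along a single row [a] sum to $1$, so it suffices that each has a power killing the
   relation. *)
have := v_row a a; rewrite eqxx => /sum1_annihilator; apply=> b.
pose Y : 'M[B]_n := \matrix_(j, l) v (a, j) (b, l).
pose c := v (a, a) (b, b).
have XY : shift_mx a b *m Y^T = c%:M.
  apply/matrixP => i j; rewrite !mxE.
  under eq_bigr do rewrite !mxE v_swap.
  by rewrite -big_distrl/= v_row -/c mulrC mulr_natr.
have Xv i j k l : shift_mx a b i k * Y j l = c * v (i, j) (k, l).
  by rewrite !mxE v_swap mulrC.
have := adj_law_rank1 h LN XY Xv => /(congr1 (fun x => e ^+ (n * N) * x)).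
rewrite mulrCA -adj_law_scale// q0 mulr0 => /esym H.
have dXY : \det (shift_mx a b) * \det Y = c ^+ n.
  by rewrite -[\det Y]det_tr -det_mulmx XY det_scalar.
(* Multiplying by $(\det Y)^N$ completes $(\det X)^N$ to $c^{nN}$; the other [N] factors are those
   already next to $\det X$. *)
exists (n * N + N)%N; rewrite -/c exprD exprM.
transitivity (\det Y ^+ N *
  (e ^+ (n * N) * ((\det (shift_mx a b) * c) ^+ N * com_eval h v L))).
  by rewrite -dXY !exprMn; ring.
by rewrite H mulr0.
Qed.

(** Without indices a relation is a scalar; this case is separate because the main argument picks a
    row. *)
Lemma com_eval_nocoord : n = 0%N -> com_eval h v L = h (com_eval id (fun _ _ => 0) L).
Proof.
move=> n0; rewrite com_eval_natural; congr (com_eval _ _ L).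
by apply/funext => -[[i i_lt] j]; exfalso; rewrite n0 in i_lt.
Qed.

Lemma unitary_relations :
  (forall g : 'M[C]_n, g \is unitarymx ->
     com_eval id (fun ij kl => g ij.1 kl.1 * (g ij.2 kl.2)^*) L = 0) ->
  com_eval h v L = 0.
Proof.
move=> g0; have [n0|n0] := posnP n.
  rewrite com_eval_nocoord//.
  rewrite -[RHS](rmorph0 h) -(g0 1%:M); last first.
    by apply/unitarymxP; rewrite trmx1 map_mx1 mulmx1.
  congr (h (com_eval _ _ _)).
  by apply/funext => -[[i i_lt] j]; exfalso; rewrite n0 in i_lt.
rewrite -[LHS]mul1r -(expr1n _ (n * N)%N); apply: shift_law_eq0 => // a b.
apply: unitary_law_eq0; first exact: adj_law_natural.
by move=> g gu; rewrite adj_law_unitary// g0// mulr0.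
Qed.

Section monomial.
Hypothesis v_row0 : forall i k l, k != l -> v (i, i) (k, l) = 0.
Hypothesis v_col0 : forall i j k, i != j -> v (i, j) (k, k) = 0.

Lemma monomial_relations :
  (forall (f : {ffun 'I_n -> 'I_n}) (t : 'I_n -> C),
     injective f -> (forall i, `|t i| = 1) ->
     let g := \matrix_(i, j) (t i *+ (f i == j)) in
     com_eval id (fun ij kl => g ij.1 kl.1 * (g ij.2 kl.2)^*) L = 0) ->
  com_eval h v L = 0.
Proof.
move=> g0; have [n0|n0] := posnP n.
  rewrite com_eval_nocoord//.
  rewrite -[RHS](rmorph0 h) -(g0 [ffun i => i] (fun=> 1)) => [|i j|i]; last first.
  - by rewrite normr1.
  - by rewrite !ffunE.
  congr (h (com_eval _ _ _)).
  by apply/funext => -[[i i_lt] j]; exfalso; rewrite n0 in i_lt.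
pose e (f : {ffun 'I_n -> 'I_n}) := \prod_i v (i, i) (f i, f i).
(* Expansion of the product over the rows [i] of the sums $\sum_k u_{ik}^2 = 1$. *)
have e1 : \sum_f e f = 1.
  rewrite -(bigA_distr_bigA (fun i k => v (i, i) (k, k))) big1// => i _.
  by rewrite v_row eqxx.
(* The successor keeps the exponent positive when [N] is $0$, so that [e f = 0] is enough for
   noninjective [f]. *)
apply: (sum1_annihilator e1) => f; exists (n * N).+1.
have [/injectiveP finj|/injectivePn[i [j ij fij]]] := boolP (injectiveb f); last first.
  suff -> : e f = 0 by rewrite expr0n mul0r.
  (* Rows [i] and [j] share a column: swapping indices between their two squares produces products
     of two distinct entries of that column. *)
  rewrite /e (bigD1 i)//= (bigD1 j) 1?eq_sym//= mulrA fij v_swap.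
  by rewrite v_col0// mul0r mul0r.
rewrite exprS -mulrA shift_law_eq0 ?mulr0// => a b.
(* Off the graph of [f], a swap with the square at [(i, f i)] produces a product of two distinct
   entries of row [i]. *)
have efX : e f *: shift_mx a b =
    \matrix_(i, j) ((e f * shift_mx a b i (f i)) *+ (f i == j)).
  apply/matrixP => i j; rewrite !mxE; case: eqP => [<-//|/eqP fij].
  rewrite /e (bigD1 i)//= mulrAC v_swap v_row0 ?mulr0 ?mul0r//.
  by rewrite eq_sym.
rewrite efX.
pose Q : poly_law C 'I_n := fun B h x =>
  adj_law L N h (\matrix_(i, j) (x i *+ (f i == j))).
have QN : natural_law Q.
  move=> D D' p k x; rewrite /Q adj_law_natural; congr (adj_law _ _ _ _).
  by apply/matrixP => i j; rewrite !mxE rmorphMn.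
apply: (natural_law_eq0 QN (@infinite_circle C) _ h
  (fun i => e f * shift_mx a b i (f i))) => t t1.
by rewrite /Q adj_law_unitary ?monomial_unitarymx// g0// mulr0.
Qed.

End monomial.
End projective_relations.

(** * Relations in star-algebras *)

Section center_of_commutant.
Variables (K : comNzRingType) (A : algType K) (S : set A).

Definition commutant : set A := [set x | forall y, S y -> x * y = y * x].

(* Commutative whatever [S] is, and contains [S] if [S] is commutative. *)
Definition center_of_commutant : {pred A} :=
  fun x => `[< commutant x /\ forall y, commutant y -> x * y = y * x >].

Fact center_of_commutant_subalg : subalg_closed center_of_commutant.
Proof.
(* Closure holds for the centralizer of any set [D]; the uses are [S] and its commutant. *)
have lin (D : set A) x y : (forall z, D z -> x * z = z * x) ->
    (forall z, D z -> y * z = z * y) -> forall (k : K) z, D z ->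
    (k *: x + y) * z = z * (k *: x + y).
  by move=> xD yD k z Dz; rewrite mulrDl mulrDr -scalerAl -scalerAr xD ?yD.
have mul (D : set A) x y : (forall z, D z -> x * z = z * x) ->
    (forall z, D z -> y * z = z * y) -> forall z, D z -> (x * y) * z = z * (x * y).
  by move=> xD yD z Dz; rewrite -mulrA yD// !mulrA xD.
split.
- by apply/asboolP; split=> y _; rewrite mul1r mulr1.
- move=> k x y /asboolP[x1 x2] /asboolP[y1 y2]; apply/asboolP; split=> z Dz.
    exact: (lin S).
  exact: (lin commutant).
- move=> x y /asboolP[x1 x2] /asboolP[y1 y2]; apply/asboolP; split=> z Dz.
    exact: (mul S).
  exact: (mul commutant).
Qed.

HB.instance Definition _ :=
  GRing.isSubalgClosed.Build K A center_of_commutant center_of_commutant_subalg.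

Record centcom := Centcom {
  centcom_val : A;
  centcom_valP : centcom_val \in center_of_commutant
}.

HB.instance Definition _ := [isSub for centcom_val].
HB.instance Definition _ := [Choice of centcom by <:].
HB.instance Definition _ := [SubChoice_isSubAlgebra of centcom by <:].

Fact centcom_mulC : @commutative centcom centcom (@GRing.mul centcom).
Proof.
move=> x y; apply: val_inj; rewrite !rmorphM /=.
have /asboolP[_ ->//] := centcom_valP x.
by have /asboolP[] := centcom_valP y.
Qed.

HB.instance Definition _ :=
  GRing.PzSemiRing_hasCommutativeMul.Build centcom centcom_mulC.

Lemma mem_centcom x :
  (forall y z, S y -> S z -> y * z = z * y) -> S x -> x \in center_of_commutant.
Proof.
move=> SC Sx; apply/asboolP; split=> [y Sy|y cy]; first exact: SC.
by rewrite cy.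
Qed.

End center_of_commutant.

Section noncommutative_evaluation.
Variables (K : comNzRingType).

Definition nc_eval (A : algType K) (J : Type) (v : J -> J -> A) (L : ncpoly K J) : A :=
  \sum_(m <- L) m.1 *: \prod_(e <- m.2) v e.1 e.2.

Lemma nc_eval_morph (A B : algType K) (J : Type) (f : {lrmorphism A -> B})
    (v : J -> J -> A) (L : ncpoly K J) :
  f (nc_eval v L) = nc_eval (fun a b => f (v a b)) L.
Proof.
by rewrite linear_sum; apply: eq_bigr => m _; rewrite linearZ rmorph_prod.
Qed.

(** Moves a relation between commuting elements into a commutative ring, where polynomial laws
    apply: the center of their commutant. *)
Lemma nc_eval_com (A : algType K) (J : Type) (v : J -> J -> A) (L : ncpoly K J) :
  (forall a b c d, v a b * v c d = v c d * v a b) ->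
  exists (B : comNzRingType) (h : {rmorphism K -> B}) (f : {rmorphism B -> A})
    (w : J -> J -> B),
    [/\ injective f, forall a b, f (w a b) = v a b & f (com_eval h w L) = nc_eval v L].
Proof.
move=> vC; pose S : set A := [set v a b | a in setT & b in setT].
have vS a b : v a b \in center_of_commutant S.
  apply: mem_centcom; last by exists a => //; exists b.
  by move=> _ _ [a1 _ [b1 _ <-]] [a2 _ [b2 _ <-]].
pose w a b : centcom S := Centcom (vS a b).
exists (centcom S), (in_alg (centcom S)), (val : centcom S -> A), w; split=> //.
rewrite rmorph_sum; apply: eq_bigr => m _.
by rewrite rmorphM rmorph_prod [X in X * _]linearZ rmorph1 mulr_algl.
Qed.

End noncommutative_evaluation.

Section star_algebras.
Variables (R : realType).
Local Notation C := (Cplx R).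

Lemma star0 (A : starAlgType R) : star (0 : A) = 0.
Proof. by apply: (addrI (star 0)); rewrite -starD !addr0. Qed.

Lemma star1 (A : starAlgType R) : star (1 : A) = 1.
Proof. by rewrite -[RHS]starK -[in RHS](mulr1 (star 1)) starM starK mulr1. Qed.

Variable J : Type.
Variable tau : J -> J.

(** The index map [tau] records how the star permutes the coordinates, so that adjoints of
    polynomials are again polynomials. *)
Definition nc_star (L : ncpoly C J) : ncpoly C J :=
  [seq (m.1^*, rev [seq (tau e.1, tau e.2) | e <- m.2]) | m <- L].

Definition nc_scale (c : C) (L : ncpoly C J) : ncpoly C J :=
  [seq (c * m.1, m.2) | m <- L].

Definition nc_mul (L M : ncpoly C J) : ncpoly C J :=
  [seq (l.1 * m.1, l.2 ++ m.2) | l <- L, m <- M].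

Section evaluation.
Variables (A : starAlgType R) (v : J -> J -> A).

Lemma nc_eval_one : nc_eval v [:: (1, [::])] = 1.
Proof. by rewrite /nc_eval big_seq1 big_nil scale1r. Qed.

Lemma nc_eval_coord a b : nc_eval v [:: (1, [:: (a, b)])] = v a b.
Proof. by rewrite /nc_eval !big_seq1 scale1r. Qed.

Lemma nc_eval_cat L M : nc_eval v (L ++ M) = nc_eval v L + nc_eval v M.
Proof. exact: big_cat. Qed.

Lemma nc_eval_scale c L : nc_eval v (nc_scale c L) = c *: nc_eval v L.
Proof.
rewrite /nc_eval big_map scaler_sumr; apply: eq_bigr => m _.
by rewrite scalerA.
Qed.

Lemma nc_eval_mul L M : nc_eval v (nc_mul L M) = nc_eval v L * nc_eval v M.
Proof.
rewrite /nc_eval big_allpairs_dep big_distrl/=; apply: eq_bigr => l _.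
rewrite big_distrr/=; apply: eq_bigr => m _.
by rewrite big_cat -scalerAl -scalerAr scalerA.
Qed.

Hypothesis star_v : forall a b, star (v a b) = v (tau a) (tau b).

Lemma nc_eval_star L : nc_eval v (nc_star L) = star (nc_eval v L).
Proof.
rewrite /nc_eval big_map (big_morph star (@starD _ _) (star0 A)).
apply: eq_bigr => m _; rewrite starZ; congr (_ *: _).
elim: m.2 => [|e s IHs]; first by rewrite !big_nil star1.
by rewrite /= rev_cons -cats1 big_cat/= big_seq1 big_cons starM star_v IHs.
Qed.

Lemma generatedP x : generated v x <-> exists L, nc_eval v L = x.
Proof.
split=> [|[L <-]].
  move=> /(_ [set y | exists L, nc_eval v L = y]); apply; split; last first.
    by move=> _ [a _ [b _ <-]]; exists [:: (1, [:: (a, b)])]; exact: nc_eval_coord.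
  split.
  - by exists [:: (1, [::])]; exact: nc_eval_one.
  - by move=> _ _ [L <-] [M <-]; exists (L ++ M); exact: nc_eval_cat.
  - by move=> _ _ [L <-] [M <-]; exists (nc_mul L M); exact: nc_eval_mul.
  - by move=> c _ [L <-]; exists (nc_scale c L); exact: nc_eval_scale.
  - by move=> _ [L <-]; exists (nc_star L); exact: nc_eval_star.
move=> P [[P1 PD PM PZ _] Pv]; apply: (big_ind P) => [|//|m _].
  (* The closure conditions do not list zero, which is obtained as [0 *: 1]. *)
  by rewrite -(scale0r 1); apply: PZ.
apply/PZ/(big_ind P) => // e _.
by apply: Pv; exists e.1 => //; exists e.2.
Qed.

End evaluation.

(** The isomorphism sends the value of a list at [v] to its value at [w]; having the same relations
    makes this well defined and injective. *)
Lemma same_qgroup_relations (A B : starAlgType R) (v : J -> J -> A) (w : J -> J -> B) :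
  (forall a b, star (v a b) = v (tau a) (tau b)) ->
  (forall a b, star (w a b) = w (tau a) (tau b)) ->
  (forall L, nc_eval v L = 0 <-> nc_eval w L = 0) ->
  same_qgroup v w.
Proof.
move=> sv sw vw.
have vwE L M : nc_eval v L = nc_eval v M <-> nc_eval w L = nc_eval w M.
  have := vw (L ++ nc_scale (-1) M).
  rewrite !nc_eval_cat !nc_eval_scale !scaleN1r => H.
  by split=> /eqP; rewrite -subr_eq0 => /eqP/H/eqP; rewrite subr_eq0 => /eqP.
have /choice[f fE] : forall x, exists y, forall L, nc_eval v L = x -> nc_eval w L = y.
  move=> x; have [[L Lx]|nx] := pselect (exists L, nc_eval v L = x).
    by exists (nc_eval w L) => M Mx; apply/vwE; rewrite Mx.
  (* Default value outside the generated algebra. *)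
  by exists 0 => L Lx; case: nx; exists L.
have fL L : f (nc_eval v L) = nc_eval w L by rewrite -(fE _ L).
exists f; split; last split.
- split.
  + by move=> _ /(generatedP sv)[L <-]; apply/(generatedP sw); exists L; rewrite fL.
  + move=> x y; rewrite !inE => /(generatedP sv)[L <-] /(generatedP sv)[M <-].
    by rewrite !fL => /vwE.
  + move=> _ /(generatedP sw)[L <-]; exists (nc_eval v L) => //.
    by apply/(generatedP sv); exists L.
- split.
  + by rewrite -(nc_eval_one v) fL nc_eval_one.
  + move=> _ _ /(generatedP sv)[L <-] /(generatedP sv)[M <-].
    by rewrite -nc_eval_cat !fL nc_eval_cat.
  + move=> _ _ /(generatedP sv)[L <-] /(generatedP sv)[M <-].
    by rewrite -nc_eval_mul !fL nc_eval_mul.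
  + move=> c _ /(generatedP sv)[L <-].
    by rewrite -nc_eval_scale !fL nc_eval_scale.
  + move=> _ /(generatedP sv)[L <-].
    by rewrite -(nc_eval_star sv) !fL (nc_eval_star sw).
- by move=> a b; rewrite -(nc_eval_coord v) fL nc_eval_coord.
Qed.

End star_algebras.

(** * Matrix C*-algebras *)

Section complex_completeness.
Variable R : realType.
Local Notation C := (Cplx R).

Lemma normc_ge_Im (z : R[i]) : (`|complex.Im z|%:C)%C <= `|z|.
Proof.
rewrite normc_def lecR -sqrtr_sqr ler_wsqrtr//.
by rewrite lerDr sqr_ge0.
Qed.

Lemma normc_le_ReIm (z : R[i]) :
  `|z| <= ((`|complex.Re z| + `|complex.Im z|)%:C)%C.
Proof.
rewrite normc_def lecR -[leRHS]ger0_norm ?addr_ge0// -sqrtr_sqr ler_wsqrtr//.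
by rewrite sqrrD !real_normK ?num_real// [leRHS]addrAC lerDl mulrn_wge0// mulr_ge0.
Qed.

Lemma cauchy_seq_real (s : nat -> R) :
  (forall e : R, 0 < e -> exists N, forall p q : nat,
     (N <= p)%N -> (N <= q)%N -> `|s p - s q| < e) ->
  exists l : R, forall e : R, 0 < e -> exists N, forall p : nat,
     (N <= p)%N -> `|s p - l| < e.
Proof.
move=> sC; have /cvg_ex[l sl] : cvgn s.
  apply: cauchy_cvg; apply: cauchy_exP => e e0; have [N NP] := sC e e0.
  by exists (s N); exists N => // p /= Np; apply: NP.
exists l => e e0; move/cvgrPdist_lt: sl => /(_ e e0)[N _ NP].
by exists N => p Np; rewrite distrC; apply: NP.
Qed.

Lemma cauchy_seq_complex (s : nat -> C) :
  (forall e : C, 0 < e -> exists N, forall p q : nat,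
     (N <= p)%N -> (N <= q)%N -> `|s p - s q| < e) ->
  exists l : C, forall e : C, 0 < e -> exists N, forall p : nat,
     (N <= p)%N -> `|s p - l| < e.
Proof.
move=> sC.
have Cpos (e : R) : 0 < e -> (0 : C) < (e%:C)%C by move=> e0; rewrite ltcR.
have [|a sa] := @cauchy_seq_real (fun k => complex.Re (s k)).
  move=> e e0; have [N NP] := sC _ (Cpos e e0); exists N => p q Np Nq.
  rewrite -ltcR -raddfB; apply: le_lt_trans (NP p q Np Nq); exact: normc_ge_Re.
have [|b sb] := @cauchy_seq_real (fun k => complex.Im (s k)).
  move=> e e0; have [N NP] := sC _ (Cpos e e0); exists N => p q Np Nq.
  rewrite -ltcR -raddfB; apply: le_lt_trans (NP p q Np Nq); exact: normc_ge_Im.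
exists (a +i* b)%C => e e0.
(* Positivity in [C] forces [e] to be real. *)
have [r r0 re] : exists2 r : R, 0 < r & e = (r%:C)%C.
  exists (complex.Re e); last by rewrite RRe_real// realE ltW.
  by move: e0; rewrite ltcE => /andP[].
have r20 : 0 < r / 2 by rewrite divr_gt0.
have [N NP] := sa _ r20; have [M MP] := sb _ r20.
exists (maxn N M) => p; rewrite geq_max => /andP[/NP pa /MP pb].
rewrite (le_lt_trans (normc_le_ReIm _))// re ltcR !raddfB /= [ltRHS]splitr.
exact: ltrD.
Qed.

End complex_completeness.

(** * Operator norms on square matrices *)

Section operator_norm.
Variables (C : numClosedFieldType) (n : nat).
Local Notation M := 'M[C]_n.+1.
Local Notation "''[' u , v ]" := (dotmx u v) : ring_scope.
Local Notation "''[' u ]" := '[u, u]%R : ring_scope.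

Definition mx_star (T : M) : M := T^t*.

Fact mx_starK : involutive mx_star.
Proof. exact: trmxCK. Qed.
Fact mx_starD : {morph mx_star : x y / x + y}.
Proof. by move=> x y; rewrite /mx_star linearD map_mxD. Qed.
Fact mx_starM (x y : M) : mx_star (x * y) = mx_star y * mx_star x.
Proof. by rewrite /mx_star trmx_mul map_mxM. Qed.
Fact mx_starZ (a : C) (x : M) : mx_star (a *: x) = a^* *: mx_star x.
Proof. by rewrite /mx_star linearZ map_mxZ. Qed.

Definition row_norm (u : 'rV[C]_n.+1) : C := sqrtC '[u].

Lemma row_norm_ge0 u : 0 <= row_norm u.
Proof. by rewrite sqrtC_ge0 dnorm_ge0. Qed.

Lemma row_norm_eq0 u : (row_norm u == 0) = (u == 0).
Proof. by rewrite sqrtC_eq0 dnorm_eq0. Qed.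

Lemma row_norm0 : row_norm 0 = 0.
Proof. by apply/eqP; rewrite row_norm_eq0. Qed.

Lemma row_normZ a u : row_norm (a *: u) = `|a| * row_norm u.
Proof. by rewrite /row_norm dnormZ sqrtCM ?nnegrE ?exprn_ge0// sqrCK. Qed.

Lemma row_normD u v : row_norm (u + v) <= row_norm u + row_norm v.
Proof. exact: triangle_lerif. Qed.

Lemma row_norm_sum (I : finType) (F : I -> 'rV[C]_n.+1) :
  row_norm (\sum_i F i) <= \sum_i row_norm (F i).
Proof.
elim/big_ind2: _ => [|a u b v ua vb|//]; first by rewrite row_norm0.
by rewrite (le_trans (row_normD u v))// lerD.
Qed.

Lemma norm_dot_le u v : `|'[u, v]| <= row_norm u * row_norm v.
Proof. exact: CauchySchwarz_sqrt. Qed.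

Lemma row_norm_sqr u : row_norm u ^+ 2 = '[u].
Proof. exact: sqrtCK. Qed.

Lemma row_normE (u : 'rV[C]_n.+1) : row_norm u ^+ 2 = \sum_i `|u 0 i| ^+ 2.
Proof.
rewrite row_norm_sqr dotmxE !mxE; apply: eq_bigr => i _.
by rewrite !mxE normCK.
Qed.

Lemma norm_coord_le (u : 'rV[C]_n.+1) i : `|u 0 i| <= row_norm u.
Proof.
rewrite -(@ler_pXn2r _ 2) ?nnegrE ?row_norm_ge0// row_normE.
by rewrite (bigD1 i)//= lerDl sumr_ge0// => j _; rewrite exprn_ge0.
Qed.

Lemma dot_adjoint (T : M) u v : '[u *m T, v] = '[u, v *m T^t*].
Proof. by rewrite !dotmxE trmx_mul map_mxM trmxCK mulmxA. Qed.

(** A crude bound: it makes the supremum defining the operator norm finite and controls that norm by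
    the entries. *)
Lemma row_norm_mul_le (T : M) v :
  row_norm (v *m T) <= (\sum_i row_norm (row i T)) * row_norm v.
Proof.
rewrite mulmx_sum_row (le_trans (row_norm_sum _))// mulr_suml.
apply: ler_sum => i _; rewrite row_normZ mulrC.
by apply: ler_wpM2l; rewrite ?row_norm_ge0 ?norm_coord_le.
Qed.

(** The norm is characterized as a least bound, from which its laws follow over any
    [numClosedFieldType]; existence rests on suprema in [R]. *)
Variable opnorm : M -> C.
Hypothesis opnorm_ge0 : forall T, 0 <= opnorm T.
Hypothesis row_norm_mul_opnorm :
  forall T v, row_norm (v *m T) <= opnorm T * row_norm v.
Hypothesis opnorm_le : forall T (m : C), 0 <= m ->
  (forall v, row_norm (v *m T) <= m * row_norm v) -> opnorm T <= m.

Lemma opnormD (x y : M) : opnorm (x + y) <= opnorm x + opnorm y.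
Proof.
apply: opnorm_le => [|v]; first by rewrite addr_ge0 ?opnorm_ge0.
rewrite mulmxDr mulrDl (le_trans (row_normD _ _))//.
by rewrite lerD ?row_norm_mul_opnorm.
Qed.

Lemma opnorm0_eq0 (x : M) : opnorm x = 0 -> x = 0.
Proof.
move=> x0; apply/row_matrixP => i; rewrite row0 rowE; apply/eqP.
rewrite -row_norm_eq0 eq_le row_norm_ge0 andbT.
by rewrite (le_trans (row_norm_mul_opnorm _ _))// x0 mul0r.
Qed.

Lemma opnormZ_le (a : C) (x : M) : opnorm (a *: x) <= `|a| * opnorm x.
Proof.
apply: opnorm_le => [|v]; first by rewrite mulr_ge0 ?opnorm_ge0.
by rewrite -scalemxAr row_normZ -mulrA ler_wpM2l ?row_norm_mul_opnorm.
Qed.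

Lemma opnormZ (a : C) (x : M) : opnorm (a *: x) = `|a| * opnorm x.
Proof.
apply/eqP; rewrite eq_le opnormZ_le/=.
have [->|a0] := eqVneq a 0; first by rewrite normr0 mul0r opnorm_ge0.
rewrite -ler_pdivlMl ?normr_gt0// -normfV.
by rewrite -{1}[x](scalerK a0) opnormZ_le.
Qed.

Lemma opnormM (x y : M) : opnorm (x * y) <= opnorm x * opnorm y.
Proof.
apply: opnorm_le => [|v]; first by rewrite mulr_ge0 ?opnorm_ge0.
have -> : v *m (x * y) = v *m x *m y by exact: mulmxA.
apply: (le_trans (row_norm_mul_opnorm y (v *m x))).
by rewrite [opnorm x * _]mulrC -mulrA ler_wpM2l ?opnorm_ge0 ?row_norm_mul_opnorm.
Qed.

(** By Cauchy-Schwarz, $|vx|^2 = \langle v, v x x^* \rangle \le \|x x^*\| |v|^2$. The order $x x^*$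
    comes from the action on row vectors. *)
Lemma opnorm_sqr_le (x : M) : opnorm x ^+ 2 <= opnorm (x * mx_star x).
Proof.
pose m := sqrtC (opnorm (x * mx_star x)).
have m0 : 0 <= m by rewrite sqrtC_ge0 opnorm_ge0.
rewrite -[leRHS]sqrtCK -/m ler_pXn2r ?nnegrE ?opnorm_ge0//.
apply: opnorm_le => // v.
rewrite -(@ler_pXn2r _ 2) ?nnegrE ?mulr_ge0 ?row_norm_ge0// exprMn [m ^+ 2]sqrtCK.
rewrite [leLHS]row_norm_sqr -[leLHS]ger0_norm ?dnorm_ge0// dot_adjoint.
have -> : v *m x *m x^t* = v *m (x * mx_star x) by rewrite -mulmxA.
rewrite (le_trans (norm_dot_le _ _))// mulrC expr2 mulrA.
by rewrite ler_wpM2r ?row_norm_ge0// row_norm_mul_opnorm.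
Qed.

(** Cancel $\|y\|$ in $\|y\|^2 \le \|y y^*\| \le \|y\| \|y^*\|$. *)
Lemma opnorm_star (x : M) : opnorm (mx_star x) = opnorm x.
Proof.
suff H y : opnorm y <= opnorm (mx_star y).
  by apply/eqP; rewrite eq_le H andbT; have := H (mx_star x); rewrite mx_starK.
have [y0|y0] := eqVneq (opnorm y) 0; first by rewrite y0 opnorm_ge0.
have yp : 0 < opnorm y by rewrite lt0r y0 opnorm_ge0.
by rewrite -(ler_pM2l yp) -expr2 (le_trans (opnorm_sqr_le y))// opnormM.
Qed.

Lemma opnorm_cstar (x : M) : opnorm (mx_star x * x) = opnorm x ^+ 2.
Proof.
apply/eqP; rewrite eq_le (le_trans (opnormM _ _)) ?opnorm_star ?expr2//=.
by have := opnorm_sqr_le (mx_star x); rewrite mx_starK opnorm_star expr2.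
Qed.

Lemma row_norm_delta i : row_norm (delta_mx 0 i) = 1.
Proof.
apply/eqP; rewrite -(@eqrXn2 _ 2) ?row_norm_ge0// expr1n row_normE (bigD1 i)//=.
rewrite big1 ?addr0 ?mxE ?eqxx ?normr1 ?expr1n// => k /negPf ki.
by rewrite mxE ki andbF normr0 expr0n.
Qed.

Lemma norm_entry_le (x : M) i j : `|x i j| <= opnorm x.
Proof.
have := row_norm_mul_opnorm x (delta_mx 0 i).
rewrite row_norm_delta mulr1 -rowE; apply: le_trans.
by have := norm_coord_le (row i x) j; rewrite mxE.
Qed.

Lemma opnorm_le_entries (x : M) : opnorm x <= \sum_i \sum_j `|x i j|.
Proof.
apply: opnorm_le => [|v].
  by apply: sumr_ge0 => i _; apply: sumr_ge0.
rewrite (le_trans (row_norm_mul_le x v))// ler_wpM2r ?row_norm_ge0//.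
apply: ler_sum => i _; rewrite [row i x]row_sum_delta.
rewrite (le_trans (row_norm_sum _))//; apply: ler_sum => j _.
by rewrite row_normZ row_norm_delta mulr1 mxE.
Qed.

(** Half of [e] is spread evenly over the entries; the halving makes the inequality strict. *)
Lemma opnorm_lt_entries (x : M) (e : C) : 0 < e ->
  (forall i j, `|x i j| <= e / 2 / n.+1%:R / n.+1%:R) -> opnorm x < e.
Proof.
move=> e0 xe; apply: (@le_lt_trans _ _ (e / 2)); last first.
  by rewrite ltr_pdivrMr// ltr_pMr// ltr1n.
apply: (le_trans (opnorm_le_entries _)).
have S (z : C) : \sum_(i < n.+1) z = z * n.+1%:R.
  by rewrite sumr_const card_ord mulr_natr.
have -> : e / 2 = \sum_(i < n.+1) \sum_(j < n.+1) (e / 2 / n.+1%:R / n.+1%:R).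
  by rewrite S S !divfK ?pnatr_eq0.
by apply: ler_sum => i _; apply: ler_sum => j _.
Qed.

End operator_norm.

Section matrix_cstar_algebra.
Variables (R : realType) (n : nat).
Local Notation C := (Cplx R).
Local Notation M := 'M[C]_n.+1.

Lemma nonneg_ReE (z : C) : 0 <= z -> ((complex.Re z)%:C)%C = z.
Proof. by move=> z0; apply: RRe_real; apply: ger0_real. Qed.

(** The supremum over the unit ball is taken in [R] through real parts, which lose nothing as norms
    are nonnegative. *)
Lemma least_row_bound (T : M) : {m : C | [/\ 0 <= m,
  forall v, row_norm (v *m T) <= m * row_norm v &
  forall m', 0 <= m' -> (forall v, row_norm (v *m T) <= m' * row_norm v) -> m <= m']}.
Proof.
pose E : set R :=
  [set complex.Re (row_norm (v *m T)) | v in [set v | row_norm v <= 1]].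
have Eub m : 0 <= m -> (forall v, row_norm (v *m T) <= m * row_norm v) ->
    ubound E (complex.Re m).
  move=> m0 mT _ [v v1 <-]; rewrite -lecR !nonneg_ReE ?row_norm_ge0//.
  by rewrite (le_trans (mT v))// ler_piMr.
have Ebnd : has_ubound E.
  exists (complex.Re (\sum_i row_norm (row i T))).
  apply: (Eub _ _ (row_norm_mul_le T)).
  by apply: sumr_ge0 => i _; exact: row_norm_ge0.
have E0 : E 0 by exists 0; rewrite /= ?mul0mx row_norm0 ?ler01.
exists (((sup E)%:C)%C); split=> [|v|m m0 mT].
- by rewrite -[0]/((0%:C)%C : C) lecR; apply: ub_le_sup.
- have [->|v0] := eqVneq v 0; first by rewrite mul0mx row_norm0 mulr0.
  have nv : 0 < row_norm v by rewrite lt0r row_norm_eq0 v0 row_norm_ge0.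
  rewrite -ler_pdivrMr// mulrC.
  have -> : (row_norm v)^-1 * row_norm (v *m T) =
      row_norm (((row_norm v)^-1 *: v) *m T).
    by rewrite -scalemxAl row_normZ ger0_norm// invr_ge0 ltW.
  rewrite -[leLHS]nonneg_ReE ?row_norm_ge0// lecR; apply: ub_le_sup => //.
  exists ((row_norm v)^-1 *: v) => //=.
  by rewrite row_normZ ger0_norm ?invr_ge0 ?row_norm_ge0// mulVf// gt_eqF.
- rewrite -(nonneg_ReE m0) lecR; apply: ge_sup; first by exists 0.
  exact: Eub.
Qed.

Definition opnorm (T : M) : C := sval (least_row_bound T).

Lemma opnorm_ge0 (T : M) : 0 <= opnorm T.
Proof. by have [] := svalP (least_row_bound T). Qed.

Lemma row_norm_mul_opnorm (T : M) v : row_norm (v *m T) <= opnorm T * row_norm v.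
Proof. by have [_] := svalP (least_row_bound T). Qed.

Lemma opnorm_le (T : M) (m : C) : 0 <= m ->
  (forall v, row_norm (v *m T) <= m * row_norm v) -> opnorm T <= m.
Proof. by have [_ _] := svalP (least_row_bound T); apply. Qed.

Lemma opnorm_complete (s : nat -> M) :
  (forall e : C, 0 < e -> exists N, forall p q : nat,
     (N <= p)%N -> (N <= q)%N -> opnorm (s p - s q) < e) ->
  exists l : M, forall e : C, 0 < e -> exists N, forall p : nat,
     (N <= p)%N -> opnorm (s p - l) < e.
Proof.
move=> sC.
have /choice[l lP] : forall k : 'I_n.+1 * 'I_n.+1, exists l : C,
    forall e : C, 0 < e -> exists N, forall p : nat,
      (N <= p)%N -> `|s p k.1 k.2 - l| < e.
  move=> [i j]; apply: cauchy_seq_complex => e /sC[N NP]; exists N => p q Np Nq.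
  apply: le_lt_trans (NP p q Np Nq).
  by rewrite (le_trans _ (norm_entry_le row_norm_mul_opnorm _ i j))// !mxE.
exists (\matrix_(i, j) l (i, j)) => e e0.
pose d : C := e / 2 / n.+1%:R / n.+1%:R.
have d0 : 0 < d by rewrite !divr_gt0.
have /choice[N NP] := fun k => lP k d d0.
exists (\max_k N k) => p Np.
apply: (opnorm_lt_entries opnorm_le e0) => i j; rewrite !mxE ltW//.
by apply: (NP (i, j)); apply: leq_trans Np; apply: leq_bigmax.
Qed.

HB.instance Definition _ := Algebra_hasStar.Build R M
  (@mx_starK C n) (@mx_starD C n) (@mx_starM C n) (@mx_starZ C n).

HB.instance Definition _ := StarAlgebra_isCStar.Build R M
  (opnormD opnorm_ge0 row_norm_mul_opnorm opnorm_le)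
  (opnormZ opnorm_ge0 row_norm_mul_opnorm opnorm_le)
  (opnorm0_eq0 row_norm_mul_opnorm)
  (opnormM opnorm_ge0 row_norm_mul_opnorm opnorm_le)
  (opnorm_cstar opnorm_ge0 row_norm_mul_opnorm opnorm_le)
  opnorm_complete.

End matrix_cstar_algebra.

(** * Half-commuting matrices *)

Section antidiagonal_matrices.
Variable C : numClosedFieldType.
Local Notation M2 := 'M[C]_2.

Definition antidiag2 (z : C) : M2 :=
  \matrix_(a, b) (if a == b then 0 else if a == 0 then z else z^*).

Definition diag2 (z : C) : M2 :=
  \matrix_(a, b) (if a == b then (if a == 0 then z else z^*) else 0).

(** This product rule turns $u_{ik} u_{jl}$ into $g_{ik} \overline{g_{jl}}$ in the model. *)
Lemma antidiag2M x y : antidiag2 x * antidiag2 y = diag2 (x * y^*).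
Proof.
apply/matrixP => a b; rewrite !mxE big_ord_recl big_ord1 !mxE.
by case: a => [[|[|//]] ?]; case: b => [[|[|//]] ?] /=;
  rewrite ?rmorphM /= ?conjCK ?(mul0r, mulr0, addr0, add0r).
Qed.

Lemma diag2_antidiag2 x y : diag2 x * antidiag2 y = antidiag2 (x * y).
Proof.
apply/matrixP => a b; rewrite !mxE big_ord_recl big_ord1 !mxE.
by case: a => [[|[|//]] ?]; case: b => [[|[|//]] ?] /=;
  rewrite ?rmorphM /= ?conjCK ?(mul0r, mulr0, addr0, add0r).
Qed.

Lemma diag2_0 : diag2 0 = 0.
Proof. by apply/matrixP => a b; rewrite !mxE rmorph0; do !case: ifP. Qed.

Lemma diag2_1 : diag2 1 = 1.
Proof. by apply/matrixP => a b; rewrite !mxE rmorph1; do !case: ifP. Qed.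

Lemma diag2D : {morph diag2 : x y / x + y}.
Proof.
by move=> x y; apply/matrixP => a b; rewrite !mxE rmorphD; do !case: ifP; rewrite ?addr0.
Qed.

Lemma antidiag2_adjoint z : mx_star (antidiag2 z) = antidiag2 z.
Proof.
apply/matrixP => a b; rewrite !mxE.
by case: a => [[|[|//]] ?]; case: b => [[|[|//]] ?] /=; rewrite ?conjCK ?rmorph0.
Qed.

Definition antidiag_mx (n : nat) (g : 'M[C]_n) : 'M[M2]_n :=
  \matrix_(i, j) antidiag2 (g i j).

Lemma antidiag_mx_unitary (n : nat) (g : 'M[C]_n) : g \is unitarymx ->
  antidiag_mx g *m (antidiag_mx g)^T = 1%:M.
Proof.
move=> /unitarymxP gu; apply/matrixP => i j; rewrite !mxE.
move/matrixP/(_ i j): gu; rewrite !mxE => gE.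
transitivity (diag2 (\sum_k g i k * g^t* k j)).
  rewrite (big_morph diag2 diag2D diag2_0); apply: eq_bigr => k _.
  by rewrite !mxE antidiag2M.
by rewrite gE; case: (i == j); rewrite ?diag2_1 ?diag2_0.
Qed.

Lemma antidiag_mx_tr_unitary (n : nat) (g : 'M[C]_n) : g \is unitarymx ->
  (antidiag_mx g)^T *m antidiag_mx g = 1%:M.
Proof.
move=> gu; have gE : (antidiag_mx g)^T = antidiag_mx g^T.
  by apply/matrixP => i j; rewrite !mxE.
by rewrite -{2}[antidiag_mx g]trmxK gE antidiag_mx_unitary ?trmx_unitary.
Qed.

(** Both sides are the antidiagonal matrix of $x \bar y z$, symmetric in [x] and [z]. *)
Lemma antidiag2_half_comm x y z :
  antidiag2 x * antidiag2 y * antidiag2 z = antidiag2 z * antidiag2 y * antidiag2 x.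
Proof. by rewrite !antidiag2M !diag2_antidiag2; congr antidiag2; ring. Qed.

(** Reading the upper left corner is multiplicative on diagonal matrices. *)
Lemma nc_eval_diag2 (J : Type) (d : J -> J -> C) (L : ncpoly C J) :
  nc_eval (fun a b => diag2 (d a b)) L 0 0 = com_eval id d L.
Proof.
rewrite /nc_eval summxE; apply: eq_bigr => m _; rewrite mxE; congr (_ * _).
elim: m.2 => [|e s IHs]; first by rewrite !big_nil mxE.
by rewrite !big_cons mxE big_ord_recl big_ord1 IHs !mxE /= mul0r addr0.
Qed.

End antidiagonal_matrices.

Section half_commutation.
Variables (R : realType) (n : nat).
Local Notation C := (Cplx R).
Local Notation I := ('I_n * 'I_n)%type.

Lemma antidiag_mx_Ostar (g : 'M[C]_n) : g \is unitarymx -> Ostar_rel (antidiag_mx g).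
Proof.
move=> gu; split.
- by move=> i j; rewrite mxE; exact: antidiag2_adjoint.
- exact: antidiag_mx_unitary.
- exact: antidiag_mx_tr_unitary.
- by move=> i1 j1 i2 j2 i3 j3; rewrite !mxE; exact: antidiag2_half_comm.
Qed.

Definition proj_coord (g : 'M[C]_n) (ij kl : I) : C := g ij.1 kl.1 * (g ij.2 kl.2)^*.

Lemma star_projective (A : starAlgType R) (u : 'M[A]_n) (ij kl : I) :
  star (projective u ij kl) = projective u (ij.2, ij.1) (kl.2, kl.1).
Proof. by rewrite /projective starM starK. Qed.

Lemma nc_eval_cts (X : ptopologicalType) (J : Type)
    (w : J -> J -> continuousType X C) (L : ncpoly C J) (x : X) :
  (nc_eval w L) x = com_eval id (fun a b => w a b x) L.
Proof.
rewrite /nc_eval (big_morph (fun f : continuousType X C => f x)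
  (fun f g => erefl) (erefl : (0 : continuousType X C) x = 0)).
apply: eq_bigr => m _; rewrite -[LHS]/(m.1 * _); congr (_ * _).
exact: (big_morph (fun f : continuousType X C => f x)
  (fun f g => erefl) (erefl : (1 : continuousType X C) x = 1)).
Qed.

Lemma nc_eval_Ucoord L :
  nc_eval (projective (Ucoord R n)) L = 0 <->
  forall g : 'M[C]_n, g \is unitarymx -> com_eval id (proj_coord g) L = 0.
Proof.
have E (x : Ugrp R n) :
    (nc_eval (projective (Ucoord R n)) L : continuousType _ _) x =
    com_eval id (proj_coord (set_val x)) L.
  rewrite nc_eval_cts; congr com_eval; apply/funext => a; apply/funext => b.
  by rewrite /projective !mxE.
split=> [L0 g gu|L0].
  have gU : g \in @unitary_group R n by rewrite inE.
  by have := E (exist _ g gU); rewrite L0.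
apply/continuousEP => x; rewrite E L0//.
by have := set_valP x.
Qed.

Lemma nc_eval_Kcoord L :
  nc_eval (projective (Kcoord R n)) L = 0 <->
  forall g : 'M[C]_n, monomial_group g -> com_eval id (proj_coord g) L = 0.
Proof.
have E (x : Kgrp R n) :
    (nc_eval (projective (Kcoord R n)) L : continuousType _ _) x =
    com_eval id (proj_coord (set_val x)) L.
  rewrite nc_eval_cts; congr com_eval; apply/funext => a; apply/funext => b.
  by rewrite /projective !mxE.
split=> [L0 g gu|L0].
  have gU : g \in @monomial_group R n by rewrite inE.
  by have := E (exist _ g gU); rewrite L0.
apply/continuousEP => x; rewrite E L0//.
by have := set_valP x.
Qed.

End half_commutation.

(** * Comparison of the relations *)

Section projective_half_liberation.
Variables (R : realType) (n : nat).
Local Notation C := (Cplx R).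
Local Notation I := ('I_n * 'I_n)%type.

Lemma monomial_mx_group (f : {ffun 'I_n -> 'I_n}) (t : 'I_n -> C) :
  injective f -> (forall i, `|t i| = 1) ->
  monomial_group (\matrix_(i, j) (t i *+ (f i == j)) : 'M[C]_n).
Proof.
move=> finj t1; have t0 i : t i != 0 by rewrite -normr_eq0 t1 oner_eq0.
have E i j : ((\matrix_(i, j) (t i *+ (f i == j)) : 'M[C]_n) i j != 0) = (f i == j).
  by rewrite mxE; case: (f i == j); rewrite ?t0 ?eqxx.
split.
- by move=> i; exists (f i); split=> [|j]; rewrite E // => /eqP.
- move=> j; have [g fg gf] := injF_bij finj.
  exists (g j); split=> [|i]; rewrite E ?gf// => /eqP <-.
  exact: fg.
- by move=> i j; rewrite E mxE => /eqP ->; rewrite eqxx t1.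
Qed.

Lemma monomial_group_unitary (g : 'M[C]_n) : monomial_group g -> g \is unitarymx.
Proof.
move=> [grow gcol g1].
have /choice[f fP] : forall i, exists j, g i j != 0 /\ forall k, g i k != 0 -> j = k.
  by move=> i; have [j] := grow i; exists j.
have finj : injective [ffun i => f i].
  move=> i j; rewrite !ffunE => fij; have [k [_ kP]] := gcol (f i).
  by rewrite -(kP i) ?(fP i).1// -(kP j)// fij (fP j).1.
have -> : g = \matrix_(i, j) (g i (f i) *+ ([ffun i => f i] i == j)).
  apply/matrixP => i j; rewrite !mxE ffunE; case: eqP => [->//|/eqP].
  by apply: contraNeq => /(fP i).2 ->.
by apply: monomial_unitarymx => // i; apply: g1; apply: (fP i).1.
Qed.

Section relations.
Variables (A : cstarAlgType R) (u : 'M[A]_n).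
Hypothesis uO : Ostar_rel u.

Lemma Ostar_projectiveE (ij kl : I) :
  projective u ij kl = u ij.1 kl.1 * u ij.2 kl.2.
Proof. by have [us _ _ _] := uO; rewrite /projective us. Qed.

(** Half-commutation reverses the last three of the four coordinates. *)
Lemma Ostar_swap i j k l a b c d :
  projective u (i, j) (k, l) * projective u (a, b) (c, d) =
  projective u (i, b) (k, d) * projective u (a, j) (c, l).
Proof.
have [_ _ _ uH] := uO; rewrite !Ostar_projectiveE /=.
by rewrite -!mulrA; congr (_ * _); rewrite !mulrA uH.
Qed.

(** Two reversals: $u_1 u_2 u_3 u_4 = u_1 u_4 u_3 u_2 = u_3 u_4 u_1 u_2$. *)
Lemma Ostar_projective_comm (a b c d : I) :
  projective u a b * projective u c d = projective u c d * projective u a b.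
Proof.
case: a b c d => [i j] [k l] [a b] [c d].
have [_ _ _ uH] := uO; rewrite Ostar_swap !Ostar_projectiveE /=.
by rewrite !mulrA uH -!mulrA; congr (_ * _); rewrite !mulrA uH.
Qed.

Lemma Ostar_row i j : \sum_k projective u (i, j) (k, k) = (i == j)%:R.
Proof.
have [_ /matrixP/(_ i j) + _ _] := uO; rewrite !mxE => <-.
by apply: eq_bigr => k _; rewrite Ostar_projectiveE mxE.
Qed.

Variable L : ncpoly C I.

Let N := \max_(m <- L) size m.2.

Let LN m : m \in L -> (size m.2 <= N)%N.
Proof. by move=> mL; apply: (@leq_bigmax_seq _ _ xpredT (fun m => size m.2) m). Qed.

Lemma Ostar_relations :
  (forall g : 'M[C]_n, g \is unitarymx -> com_eval id (proj_coord g) L = 0) ->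
  nc_eval (projective u) L = 0.
Proof.
move=> g0; have [B [h [f [w [finj fw <-]]]]] := nc_eval_com L Ostar_projective_comm.
rewrite (@unitary_relations C n B h w _ _ L N LN) ?rmorph0 //.
- by move=> *; apply: finj; rewrite !rmorphM !fw; exact: Ostar_swap.
- move=> i j; apply: finj; rewrite rmorph_sum rmorph_nat -Ostar_row.
  by apply: eq_bigr => k _; exact: fw.
Qed.

Lemma Hstar_relations : Hstar_rel u ->
  (forall g : 'M[C]_n, monomial_group g -> com_eval id (proj_coord g) L = 0) ->
  nc_eval (projective u) L = 0.
Proof.
move=> [_ uH] g0; have [B [h [f [w [finj fw <-]]]]] := nc_eval_com L Ostar_projective_comm.
rewrite (@monomial_relations C n B h w _ _ L N LN) ?rmorph0 //.
- by move=> *; apply: finj; rewrite !rmorphM !fw; exact: Ostar_swap.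
- move=> i j; apply: finj; rewrite rmorph_sum rmorph_nat -Ostar_row.
  by apply: eq_bigr => k _; exact: fw.
- move=> i k l kl; apply: finj; rewrite fw rmorph0 Ostar_projectiveE /=.
  by have [] := uH i k l kl.
- move=> i j k ij; apply: finj; rewrite fw rmorph0 Ostar_projectiveE /=.
  by have [] := uH k i j ij.
- by move=> p t pinj t1 /=; apply: g0; exact: monomial_mx_group.
Qed.

End relations.

(** The morphism sends projective coordinates to diagonal matrices, whose corners are the $g_{ik}
    \overline{g_{jl}}$. *)
Lemma nc_eval_model (A : cstarAlgType R) (u : 'M[A]_n) (g : 'M[C]_n)
    (f : {lrmorphism A -> 'M[C]_2}) (L : ncpoly C I) :
  star_hom f -> (forall i j, f (u i j) = antidiag_mx g i j) ->
  nc_eval (projective u) L = 0 -> com_eval id (proj_coord g) L = 0.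
Proof.
move=> fs fu L0; rewrite -nc_eval_diag2.
have -> : (fun a b => diag2 (proj_coord g a b)) = (fun a b => f (projective u a b)).
  apply/funext => a; apply/funext => b.
  have fsE x : f (star x) = star (f x) by exact: fs.
  rewrite /projective rmorphM /= fsE !fu !mxE [star _]antidiag2_adjoint.
  by rewrite antidiag2M.
by rewrite -nc_eval_morph L0 rmorph0 mxE.
Qed.

End projective_half_liberation.

Theorem theorem2p6 (R : realType) (n : nat) :
  (forall (A : cstarAlgType R) (u : 'M[A]_n), is_C_Ostar u ->
     same_qgroup (projective u) (projective (Ucoord R n))) /\
  (forall (A : cstarAlgType R) (u : 'M[A]_n), is_C_Hstar u ->
     same_qgroup (projective u) (projective (Kcoord R n))).
Proof.
pose tau (ij : 'I_n * 'I_n) := (ij.2, ij.1).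
split=> A u [uR univ]; apply: (same_qgroup_relations (tau := tau)) => [a b|a b|L];
  try exact: star_projective.
- split=> [L0|/nc_eval_Ucoord L0]; last exact: Ostar_relations.
  apply/nc_eval_Ucoord => g gu.
  have [f [fs fu _]] := univ _ _ (antidiag_mx_Ostar gu).
  exact: (nc_eval_model fs fu).
- split=> [L0|/nc_eval_Kcoord L0]; last by apply: Hstar_relations => //; case: uR.
  apply/nc_eval_Kcoord => g gK.
  (* Distinct entries of one row or column of a monomial matrix have product zero, which gives the
     cubic relations in the model. *)
  have gH : Hstar_rel (antidiag_mx g : 'M['M[Cplx R]_2]_n).
    split; first exact/antidiag_mx_Ostar/monomial_group_unitary.
    move=> i j k jk; rewrite !mxE !antidiag2M.
    have [grow gcol _] := gK.
    suff [-> ->] : g i j * (g i k)^* = 0 /\ g j i * (g k i)^* = 0 by rewrite diag2_0.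
    split; apply/eqP; rewrite mulf_eq0 conjC_eq0; apply/contraT.
      rewrite negb_or => /andP[a b]; have [l [_ lP]] := grow i.
      by move: jk; rewrite -(lP _ a) -(lP _ b) eqxx.
    rewrite negb_or => /andP[a b]; have [l [_ lP]] := gcol i.
    by move: jk; rewrite -(lP _ a) -(lP _ b) eqxx.
  have [f [fs fu _]] := univ _ _ gH.
  exact: (nc_eval_model fs fu).
Qed.
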